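(* Let $\theta$ be a real number with $\frac12\le\theta\le 1$. Then $|S_\theta(z_0,z_1,z_2)|\le 1$ whenever $z_0,z_1,z_2\in\mathbb{C}$ satisfy $$|z_0|\le 2\sqrt{\Re z_1\,\Re z_2},\qquad \Re z_1\le 0,\qquad \Re z_2\le 0.$$
   Context: For a real parameter $\theta>0$ and $z_0,z_1,z_2\in\mathbb{C}$ with $\Re z_1\le 0$, $\Re z_2\le 0$, set $z=z_1+z_2$ and $p=(1-\theta z_1)(1-\theta z_2)$ (which is nonzero), and define $$S_\theta(z_0,z_1,z_2)=1+\frac{z_0+z}{p}+\theta\,\frac{z_0(z_0+z)}{p^2}+\left(\tfrac12-\theta\right)\frac{(z_0+z)^2}{p^2}.$$ This is the stability function of the Modified Craig--Sneyd (MCS) scheme with parameter $\theta$ applied to the scalar test equation $U'(t)=(\lambda_0+\lambda_1+\lambda_2)U(t)$ with $z_j=\Delta t\,\lambda_j$. *)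

(* Defs.v *)
From Stdlib Require Import Reals.
From Coquelicot Require Import Coquelicot.

Open Scope R_scope.

(* Stability function of the Modified Craig--Sneyd scheme with parameter theta.
   It is used only for theta > 0 and Re z1, Re z2 <= 0, where p <> 0, so that the
   value of Coquelicot's total complex division at 0 plays no role. *)
Definition mcs_stab (theta : R) (z0 z1 z2 : C) : C :=
  let z := (z1 + z2)%C in
  let p := ((1 - theta * z1) * (1 - theta * z2))%C in
  (1 + (z0 + z) / p
     + theta * ((z0 * (z0 + z)) / p ^ 2)
     + RtoC (1 / 2 - theta)%R * ((z0 + z) ^ 2 / p ^ 2))%C.

(* Main.v *)
Require Import Defs.
From Stdlib Require Import Reals.
From Stdlib Require Import Lra.
From Coquelicot Require Import Coquelicot.

(** Put [alpha = 1 + 2 theta z / p], [gamma = 2 theta z0 / p] and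
    [t = 1 / (2 theta)].  Since [p alpha = (1 + theta z1) (1 + theta z2)] and
    [|1 - theta zj|^2 = |1 + theta zj|^2 - 4 theta Re zj], the Cauchy-Schwarz
    inequality in the plane gives [|alpha| + |gamma| <= 1].  The stability function
    is a polynomial in [alpha], [gamma] with real coefficients, all nonnegative
    except that of [alpha^2]; a direct estimate of the part depending on [alpha]
    only shows that the modulus is nevertheless largest at nonnegative real
    arguments, where the bound is elementary. *)

Lemma Cmod_quadratic_le (c0 c1 c2 : R) (a : C) :
  0 <= c0 + c1 * Cmod a - c2 * Cmod a ^ 2 ->
  0 <= c0 * c2 ->
  4 * (c0 * c2) * Cmod a <= c1 * (c0 - c2 * Cmod a ^ 2) ->
  Cmod (c0 + c1 * a - c2 * (a * a))%C <= c0 + c1 * Cmod a - c2 * Cmod a ^ 2.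
Proof.
  intros Hpos Hc H.
  apply Rsqr_incr_0_var; [rewrite !Rsqr_pow2, Cmod2_alt | exact Hpos].
  pose proof (Cmod2_alt a) as Hs.
  pose proof (Rle_trans _ _ _ (Rle_abs _) (re_le_Cmod a)) as Ha.
  set (s := Cmod a) in *; clearbody s.
  destruct a as [x y]; unfold Re, Im in *; simpl fst in *; simpl snd in *.
  assert (Hy : y ^ 2 = s ^ 2 - x ^ 2) by lra.
  (* With the modulus [s] fixed, this product is the square of the claimed bound minus the squared
     modulus on the left. Since [x <= s], the last hypothesis keeps the second factor
     nonnegative. *)
  assert (D : 0 <= (s - x) *
                   (2 * (c1 * (c0 - c2 * s ^ 2)) - 4 * (c0 * c2) * (s + x)))
    by (apply Rmult_le_pos; nra).
  match goal with |- ?l <= _ => replace l with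
    (c0 ^ 2 + c1 ^ 2 * (x ^ 2 + y ^ 2) + c2 ^ 2 * (x ^ 2 + y ^ 2) ^ 2
     + 2 * c1 * x * (c0 - c2 * (x ^ 2 + y ^ 2)) - 2 * c0 * c2 * (x ^ 2 - y ^ 2))
    by (simpl; ring) end.
  rewrite <- Hs, Hy; lra.
Qed.

(** This polynomial is twice the stability function, with [a] as alpha and [g] as gamma. The
    cofactor of [g] has nonnegative coefficients, so the triangle inequality suffices there; only
    the part in [a] alone needs [Cmod_quadratic_le]. *)
Lemma Cmod_stab_polynomial_le (t : R) (a g : C) :
  1 / 2 <= t <= 1 -> Cmod a + Cmod g <= 1 ->
  Cmod (((1 - t) * (2 - t))%R + (2 * t * (2 - t))%R * a - (t * (1 - t))%R * (a * a)
        + g * ((t * (3 - 2 * t))%R + (t * (2 * t - 1))%R * a + (t * t)%R * g))%C <= 2.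
Proof.
  intros Ht H.
  pose proof (Cmod_ge_0 a) as Ha; pose proof (Cmod_ge_0 g) as Hg.
  eapply Rle_trans; [apply Cmod_triangle |].
  rewrite Cmod_mult.
  assert (H1 := Cmod_quadratic_le ((1 - t) * (2 - t)) (2 * t * (2 - t))
                  (t * (1 - t)) a).
  assert (H2 : Cmod ((t * (3 - 2 * t))%R + (t * (2 * t - 1))%R * a
                     + (t * t)%R * g)%C
               <= t * (3 - 2 * t) + t * (2 * t - 1) * Cmod a + t * t * Cmod g).
  { eapply Rle_trans; [apply Cmod_triangle |].
    apply Rplus_le_compat; [eapply Rle_trans; [apply Cmod_triangle |]; apply Rplus_le_compat |];
      rewrite ?Cmod_mult, Cmod_R, Rabs_pos_eq; nra. }
  set (s := Cmod a) in *; set (r := Cmod g) in *; clearbody s r.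
  assert (0 <= t * (1 - t)) by nra.
  assert (0 <= (1 - t) * (2 - t)) by nra.
  assert (H1' := H1 ltac:(nra) ltac:(nra)); clear H1.
  (* The last hypothesis of [Cmod_quadratic_le], right side minus left side, in factored form. *)
  assert (K : 0 <= (2 * t * (1 - t) * (2 - t)) * ((1 - s) * (2 - t + t * s)))
    by (repeat apply Rmult_le_pos; nra).
  specialize (H1' ltac:(nra)).
  apply (Rmult_le_compat_l r) in H2; [| exact Hg].
  (* This product equals 2 minus the value of the polynomial at the real arguments [s] and [r]. *)
  assert (E : 0 <= t * (1 - s - r) * (3 - s - t * (1 - s - r)))
    by (repeat apply Rmult_le_pos; nra).
  nra.
Qed.

Lemma Cmod2_Cayley (x : R) (z : C) :
  Cmod (1 - x * z)%C ^ 2 = Cmod (1 + x * z)%C ^ 2 - 4 * x * Re z.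
Proof.
  rewrite !Cmod2_alt; destruct z as [u v]; unfold Re, Im; simpl; ring.
Qed.

Lemma Cauchy_Schwarz_plane (a b c d u v : R) :
  0 <= u -> 0 <= v -> a ^ 2 + c ^ 2 = u ^ 2 -> b ^ 2 + d ^ 2 = v ^ 2 ->
  a * b + c * d <= u * v.
Proof.
  intros Hu Hv H1 H2.
  apply Rsqr_incr_0_var; [rewrite !Rsqr_pow2 | nra].
  replace ((u * v) ^ 2) with (u ^ 2 * v ^ 2) by ring.
  rewrite <- H1, <- H2.
  (* By Lagrange's identity this square is the difference of the two sides. *)
  pose proof (pow2_ge_0 (a * d - b * c)); nra.
Qed.

(** Cauchy-Schwarz applies to the vectors with entries [Cmod (1 + x * zj)] and
    [sqrt (4 * x * - Re zj)], whose lengths are [Cmod (1 - x * zj)]. The second entries multiply to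
    [4 * x * sqrt (Re z1 * Re z2)], which dominates the [z0] term. *)
Lemma Cmod_product_bound (x : R) (z0 z1 z2 : C) :
  0 <= x -> Cmod z0 <= 2 * sqrt (Re z1 * Re z2) -> Re z1 <= 0 -> Re z2 <= 0 ->
  Cmod ((1 + x * z1) * (1 + x * z2))%C + Cmod ((2 * x)%R * z0)%C
    <= Cmod ((1 - x * z1) * (1 - x * z2))%C.
Proof.
  intros Hx H0 H1 H2.
  rewrite !Cmod_mult, Cmod_R, Rabs_pos_eq by lra.
  eapply Rle_trans;
    [| apply (Cauchy_Schwarz_plane (Cmod (1 + x * z1)%C) (Cmod (1 + x * z2)%C)
              (sqrt (4 * x * - Re z1)) (sqrt (4 * x * - Re z2)));
       try apply Cmod_ge_0; rewrite pow2_sqrt by nra; rewrite (Cmod2_Cayley x); lra].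
  rewrite <- sqrt_mult by nra.
  replace (4 * x * - Re z1 * (4 * x * - Re z2))
    with ((4 * x) * (4 * x) * (Re z1 * Re z2)) by ring.
  rewrite sqrt_mult, sqrt_square by nra.
  nra.
Qed.

Lemma one_minus_neq_0 (x : R) (z : C) :
  0 <= x -> Re z <= 0 -> (1 - x * z)%C <> 0.
Proof.
  intros Hx Hz E; apply (f_equal Re) in E.
  destruct z as [u v]; unfold Re in *; simpl in *; nra.
Qed.

Theorem theorem7 :
  forall theta : R, 1 / 2 <= theta <= 1 ->
  forall z0 z1 z2 : C,
    Cmod z0 <= 2 * sqrt (Re z1 * Re z2) ->
    Re z1 <= 0 ->
    Re z2 <= 0 ->
    Cmod (mcs_stab theta z0 z1 z2) <= 1.
Proof.
  intros theta Htheta z0 z1 z2 H0 H1 H2.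
  assert (N1 : (1 - theta * z1)%C <> 0) by (apply one_minus_neq_0; lra).
  assert (N2 : (1 - theta * z2)%C <> 0) by (apply one_minus_neq_0; lra).
  assert (Nt : RtoC theta <> 0) by (intros E; apply RtoC_inj in E; lra).
  assert (Np := Cmult_neq_0 _ _ N1 N2).
  set (t := / (2 * theta)).
  assert (Ht : 1 / 2 <= t <= 1).
  { unfold t; split.
    - replace (1 / 2) with (/ 2) by lra; apply Rinv_le_contravar; lra.
    - rewrite <- Rinv_1; apply Rinv_le_contravar; lra. }
  set (p := ((1 - theta * z1) * (1 - theta * z2))%C) in *.
  assert (B := Cmod_stab_polynomial_le t
                 ((1 + theta * z1) * (1 + theta * z2) / p)%C
                 ((2 * theta)%R * z0 / p)%C Ht).
  rewrite !Cmod_div in B by exact Np.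
  assert (Hp : 0 < Cmod p) by (apply Cmod_gt_0; exact Np).
  apply (Rmult_le_reg_l 2); [lra |]; rewrite Rmult_1_r.
  replace (2 * Cmod (mcs_stab theta z0 z1 z2))
    with (Cmod (RtoC 2 * mcs_stab theta z0 z1 z2)%C)
    by (rewrite Cmod_mult, Cmod_R, Rabs_pos_eq; lra).
  (* Since [2 * theta * t = 1], one has [z0 / p = t * gamma] and [(z1 + z2) / p = t * (alpha - 1)];
     substitution turns twice the stability function into the polynomial in [B]. *)
  match type of B with _ -> Cmod ?P <= _ =>
    replace (RtoC 2 * mcs_stab theta z0 z1 z2)%C with P end.
  - apply B.
    apply (Rmult_le_reg_r (Cmod p)); [exact Hp |].
    assert (L := Cmod_product_bound theta z0 z1 z2 ltac:(lra) H0 H1 H2).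
    fold p in L.
    replace ((Cmod ((1 + theta * z1) * (1 + theta * z2)) / Cmod p
              + Cmod ((2 * theta)%R * z0) / Cmod p) * Cmod p)
      with (Cmod ((1 + theta * z1) * (1 + theta * z2))%C
            + Cmod ((2 * theta)%R * z0)%C) by (field; lra).
    lra.
  - unfold mcs_stab, t, p.
    repeat first [rewrite RtoC_plus | rewrite RtoC_minus | rewrite RtoC_mult
                 | rewrite RtoC_inv by lra | rewrite RtoC_div by lra].
    field.
    repeat split; assumption.
Qed.
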